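(* Let $G$ be a connected graph and let $\phi$ be a strong parity edge-coloring of $G$. Then there exist a canonical edge-coloring $\phi^*$ of $G$ and a map $\pi$ from the set of colors used by $\phi$ to the set of colors used by $\phi^*$ (not necessarily injective) such that $\phi^*=\pi\circ\phi$; that is, $\phi$ is isomorphic to a refinement of a canonical edge-coloring. In particular, $\hat{p}(G)$ equals the minimum number of colors used by a canonical edge-coloring of $G$.
   Context: An edge-coloring of a graph assigns a color to each edge. Given an edge-coloring, a walk is a parity walk if every color appears an even number of times along a traversal of the walk (counted with multiplicity); a walk is open if its endpoints are distinct. A strong parity edge-coloring (spec) is an edge-coloring admitting no open parity walk; $\hat{p}(G)$ is the minimum number of colors in a spec of $G$. A binary labeling of $G$ is an injective map $f\colon V(G)\to \mathbb{V}$ where $\mathbb{V}$ is a vector space over $\mathbb{F}_2$. A canonical edge-coloring of $G$ is an edge-coloring $\phi$ arising from some binary labeling $f$ by $\phi(uv)=f(u)+f(v)$ for each edge $uv$. *)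

(* Defs.v *)
From HB Require Import structures.
From mathcomp Require Import all_boot all_order all_algebra.
From mathcomp Require Import boolp.
Set Implicit Arguments.
Unset Strict Implicit.
Unset Printing Implicit Defensive.
Import GRing.Theory.
Local Open Scope ring_scope.

Record sgraph := SGraph {
  vertex :> finType;
  adj : rel vertex;
  adj_sym : symmetric adj;
  adj_irrefl : irreflexive adj }.

Arguments adj {s}.

Definition connected (G : sgraph) : Prop :=
  forall u v : G, connect adj u v.

Definition edges (G : sgraph) : {set {set G}} :=
  [set e | [exists u : G, exists v : G, adj u v && (e == [set u; v])]].

Definition edge (G : sgraph) : finType := {e : {set G} | e \in edges G}.

Definition coloring (G : sgraph) (C : eqType) := edge G -> C.

Definition used (G : sgraph) (C : eqType) (phi : coloring G C) : Type :=
  {c : C | c \in codom phi}.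

(* [phi], with its codomain restricted to the colors it uses. *)
Definition to_used (G : sgraph) (C : eqType) (phi : coloring G C)
    (e : edge G) : used phi :=
  exist _ (phi e) (codom_f phi e).

Definition num_colors (G : sgraph) (C : eqType) (phi : coloring G C) : nat :=
  size (undup (codom phi)).

(* As the graph is simple, a walk is determined by its first vertex [u] and
   the sequence of edges it traverses; [v] is its last vertex. *)
Fixpoint walk (G : sgraph) (u : G) (es : seq (edge G)) (v : G) : bool :=
  if es is e :: es' then
    [exists w : G, (val e == [set u; w]) && walk w es' v]
  else u == v.

Definition parity (G : sgraph) (C : eqType) (phi : coloring G C)
    (es : seq (edge G)) : Prop :=
  forall c : C, ~~ odd (count_mem c (map phi es)).

(* Strong parity edge-coloring: no open parity walk. *)
Definition spec (G : sgraph) (C : eqType) (phi : coloring G C) : Prop :=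
  ~ exists (u v : G) (es : seq (edge G)),
      [/\ walk u es v, u != v & parity phi es].

Definition canonical (G : sgraph) (V : lmodType 'F_2) (phi : coloring G V) :
    Prop :=
  exists2 f : G -> V, injective f &
    forall (e : edge G) (u v : G), val e = [set u; v] -> phi e = f u + f v.

Definition has_spec (G : sgraph) (k : nat) : Prop :=
  exists (C : eqType) (phi : coloring G C), spec phi /\ num_colors phi = k.

Definition has_canonical (G : sgraph) (k : nat) : Prop :=
  exists (V : lmodType 'F_2) (phi : coloring G V),
    canonical phi /\ num_colors phi = k.

Lemma addvv (V : lmodType 'F_2) (x : V) : x + x = 0.
Proof.
rewrite -[x]scale1r -scalerDl.
by have -> : 1 + 1 = 0 :> 'F_2 by [apply: val_inj]; rewrite scale0r.
Qed.

Lemma edge_neq (G : sgraph) (e : edge G) (u v : G) :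
  val e = [set u; v] -> u != v.
Proof.
move=> ev; have := valP e; rewrite inE ev.
case/existsP=> x /existsP[y /andP[xy /eqP exy]].
apply/eqP => uv; move: exy; rewrite uv setUid => exy.
have : x \in [set v] by rewrite exy !inE eqxx.
have : y \in [set v] by rewrite exy !inE eqxx orbT.
by rewrite !inE => /eqP yv /eqP xv; move: xy; rewrite xv yv adj_irrefl.
Qed.

Lemma canonical_spec (G : sgraph) (V : lmodType 'F_2) (phi : coloring G V) :
  canonical phi -> spec phi.
Proof.
move=> [f f_inj fphi] [u [v [es [w_es /eqP neq_uv even_es]]]].
have sum_f : \sum_(e <- es) phi e = f u + f v.
  elim: es u w_es {neq_uv even_es} => [|e es IHes] u /=.
    by move=> /eqP ->; rewrite big_nil addvv.
  case/existsP=> w /andP[/eqP eE /IHes IHw].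
  by rewrite big_cons IHw (fphi _ _ _ eE) addrA -(addrA (f u)) addvv addr0.
have sum0 : \sum_(e <- es) phi e = 0.
  rewrite -(big_map phi xpredT id) -big_undup_iterop_count big1 // => x _.
  rewrite -[iterop _ _ _ _]/(x *+ count_mem x (map phi es)).
  rewrite -[count_mem _ _]odd_double_half (negPf (even_es x)) add0n.
  by rewrite -mul2n mulrnA mulr2n addvv mul0rn.
apply/neq_uv/f_inj/(addIr (f v)).
by rewrite addvv -sum_f sum0.
Qed.

Lemma ex_canonical (G : sgraph) : exists k, `[< has_canonical G k >].
Proof.
pose f (v : G) : 'rV['F_2]_#|G| := delta_mx 0 (enum_rank v).
pose phi : coloring G 'rV['F_2]_#|G| := fun e => \sum_(x in val e) f x.
exists (num_colors phi); apply/asboolP; exists 'rV['F_2]_#|G|, phi.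
split=> //; exists f => [u v fuv | e u v ev].
  have := congr1 (fun m : 'rV['F_2]_#|G| => m 0 (enum_rank u)) fuv.
  apply: contra_eq => neq_uv.
  rewrite /f !mxE !eqxx (inj_eq enum_rank_inj).
  by rewrite (negPf neq_uv).
by rewrite /phi ev big_setU1 ?big_set1 // inE (edge_neq ev).
Qed.

Lemma ex_spec (G : sgraph) : exists k, `[< has_spec G k >].
Proof.
have [k /asboolP[V [phi [can_phi phi_k]]]] := ex_canonical G.
exists k; apply/asboolP; exists V, phi; split=> //.
exact: canonical_spec.
Qed.

(* $\hat p(G)$ *)
Definition spec_number (G : sgraph) : nat := ex_minn (ex_spec G).

Definition canonical_number (G : sgraph) : nat := ex_minn (ex_canonical G).

(* Main.v *)
From mathcomp Require Import boolp.
Require Import Defs.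
From mathcomp Require Import all_boot all_order all_algebra.
Set Implicit Arguments.
Unset Strict Implicit.
Unset Printing Implicit Defensive.
Import GRing.Theory.

(** Fix a root [r].  The parity vectors of the closed walks at [r] form a
    subspace [S] of the color space over ['F_2].  Label each vertex [v] by the
    parity vector, modulo [S], of some walk from [r] to [v].  An edge [uv] then
    gets the class of the basis vector of its color, since going from [r] to
    [u], along [uv], and back to [r] is a closed walk.  If [u] and [v] have the
    same label, inserting a suitable closed walk at [r] between the chosen walks
    yields a parity walk from [u] to [v], so that [u = v]. *)

Local Open Scope ring_scope.

Section Walks.
Variable G : sgraph.
Implicit Types (u v w : G) (e : edge G) (es : seq (edge G)).

Lemma walk_cat u v w es1 es2 :
  walk u es1 v -> walk v es2 w -> walk u (es1 ++ es2) w.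
Proof.
elim: es1 u => [|e es1 IHes] u /= => [/eqP-> //|].
case/existsP=> x /andP[ex /IHes IHx] /IHx w2.
by apply/existsP; exists x; rewrite ex.
Qed.

Lemma walk1 e u v : val e = [set u; v] -> walk u [:: e] v.
Proof. by move=> ev; apply/existsP; exists v; rewrite ev !eqxx. Qed.

Lemma walk_rev u v es : walk u es v -> walk v (rev es) u.
Proof.
elim: es u => [|e es IHes] u /= => [/eqP->|]; first exact: eqxx.
case/existsP=> x /andP[/eqP ex /IHes wx].
by rewrite rev_cons -cats1; apply: walk_cat wx (walk1 _); rewrite setUC.
Qed.

Lemma connect_walk u v : connect adj u v -> exists es, walk u es v.
Proof.
case/connectP=> p; elim: p u => [|x p IHp] u /=.
  by move=> _ ->; exists [::] => /=.
case/andP=> ux /IHp path_x /path_x[es w_es].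
have ux_edge : [set u; x] \in edges G.
  by rewrite inE; apply/existsP; exists u; apply/existsP; exists x; rewrite ux /=.
pose e : edge G := exist _ [set u; x] ux_edge.
by exists (e :: es); apply: (@walk_cat u x v [:: e]) => //; apply: walk1.
Qed.

End Walks.

Section F2.

Lemma oppv2 (V : lmodType 'F_2) (x : V) : - x = x.
Proof. by apply/eqP; rewrite eq_sym -addr_eq0 Defs.addvv. Qed.

Lemma natrF2_eq0 n : (n%:R == 0 :> 'F_2) = ~~ odd n.
Proof. by rewrite -(dvdn_pcharf (pchar_Fp (isT : prime 2))) dvdn2. Qed.

Lemma F2_cases (a : 'F_2) : a = 0 \/ a = 1.
Proof.
by case: a => [[|[|m]] lt_m] //; [left | right]; apply: val_inj.
Qed.

(** Over ['F_2] the only scalars are 0 and 1, so closure under addition already makes [S] a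
    subspace: it is the row space of the matrix listing its elements, and [K] is a cokernel of that
    matrix. *)
Lemma subgroup_kernel n (S : {set 'rV['F_2]_n}) :
    0 \in S -> (forall x y, x \in S -> y \in S -> x + y \in S) ->
  exists K : 'M['F_2]_n, forall x : 'rV_n, (x *m K == 0) = (x \in S).
Proof.
move=> S0 SD; pose A := \matrix_(i < #|S|) (enum_val i : 'rV['F_2]_n).
exists (cokermx A) => x; apply/idP/idP.
  move=> xK; have /submxP[D ->] : (x <= A)%MS by rewrite submxE.
  rewrite mulmx_sum_row; apply: (big_ind (fun y => y \in S)) => // i _; rewrite rowK.
  by case: (F2_cases (D 0 i)) => ->; rewrite ?scale0r ?scale1r // enum_valP.
move=> xS; rewrite -submxE; suff -> : x = row (enum_rank_in xS x) A.
  exact: row_sub.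
by rewrite rowK enum_rankK_in.
Qed.

End F2.

Section ParityVector.
Variables (G : sgraph) (C : eqType) (phi : coloring G C).
Implicit Types (e : edge G) (es : seq (edge G)).

(* Coordinates are indexed by edges rather than by used colors, each color being
   represented by all the edges bearing it. *)
Definition parity_vec es : 'rV['F_2]_#|edge G| :=
  \row_j (count_mem (phi (enum_val j)) (map phi es))%:R.

Lemma parity_vec_nil : parity_vec [::] = 0.
Proof. by apply/rowP => j; rewrite !mxE. Qed.

Lemma parity_vec_cat es1 es2 :
  parity_vec (es1 ++ es2) = parity_vec es1 + parity_vec es2.
Proof. by apply/rowP => j; rewrite !mxE map_cat count_cat natrD. Qed.

Lemma parity_vec_rev es : parity_vec (rev es) = parity_vec es.
Proof. by apply/rowP => j; rewrite !mxE map_rev count_rev. Qed.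

Lemma parity_vec1 e e' :
  phi e = phi e' -> parity_vec [:: e] = parity_vec [:: e'].
Proof. by move=> ee'; apply/rowP => j; rewrite !mxE /= ee'. Qed.

(** A color met by [es] is borne by some edge, hence has a coordinate; any other color is counted 0
    times. *)
Lemma parity_vec_eq0 es : parity_vec es = 0 -> parity phi es.
Proof.
move=> es0 c; have [c_es | c_es] := boolP (c \in map phi es); last first.
  by rewrite (count_memPn c_es).
have [e _ ->] := mapP c_es.
have := congr1 (fun m : 'rV['F_2]_#|edge G| => m 0 (enum_rank e)) es0.
by rewrite !mxE enum_rankK => /eqP; rewrite natrF2_eq0.
Qed.

End ParityVector.

Lemma spec_factor_rooted (G : sgraph) (r : G) (C : eqType)
    (phi : coloring G C) :
    (forall v, connect adj r v) -> spec phi ->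
  exists (V : lmodType 'F_2) (phi' : coloring G V),
    canonical phi' /\ forall e e', phi e = phi e' -> phi' e = phi' e'.
Proof.
move=> r_conn phi_spec; pose vec := parity_vec phi.
have [p pP] := choice (fun v => connect_walk (r_conn v)).
pose S := [set x : 'rV['F_2]_#|edge G| | `[< exists2 es, walk r es r & vec es = x >]].
have inS es : walk r es r -> vec es \in S.
  by move=> w_es; rewrite inE; apply/asboolP; exists es.
have [||K KP] := @subgroup_kernel _ S.
- by rewrite -(parity_vec_nil phi); apply: inS => /=.
- move=> x y; rewrite !inE => /asboolP[es1 w1 <-] /asboolP[es2 w2 <-].
  apply/asboolP; exists (es1 ++ es2); first exact: walk_cat w1 w2.
  exact: parity_vec_cat.
(* Multiplication by [K] has kernel [S], so it stands for reduction modulo [S]. *)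
exists 'rV_#|edge G|, (fun e => vec [:: e] *m K); split=> [|e e' ee'].
  exists (fun v => vec (p v) *m K) => [u v fuv | e u v ev].
    have /eqP : (vec (p u) + vec (p v)) *m K = 0.
      by rewrite mulmxDl fuv Defs.addvv.
    rewrite KP inE => /asboolP[es w_es es_vec].
    apply/eqP/negPn/negP => neq_uv; apply: phi_spec.
    exists u, v, (rev (p u) ++ es ++ p v); split=> //.
      exact: walk_cat (walk_rev (pP u)) (walk_cat w_es (pP v)).
    apply: parity_vec_eq0; rewrite !parity_vec_cat parity_vec_rev.
    by rewrite -/vec es_vec -addrA Defs.addvv addr0 Defs.addvv.
  have : vec (p u ++ [:: e] ++ rev (p v)) \in S.
    apply: inS; apply: walk_cat (pP u) _.
    exact: walk_cat (walk1 ev) (walk_rev (pP v)).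
  rewrite -KP /vec !parity_vec_cat parity_vec_rev -/vec addrCA mulmxDl addr_eq0.
  by move/eqP->; rewrite oppv2 mulmxDl.
by rewrite /vec (parity_vec1 ee').
Qed.

Lemma spec_factor (G : sgraph) (C : eqType) (phi : coloring G C) :
    connected G -> spec phi ->
  exists (V : lmodType 'F_2) (phi' : coloring G V),
    canonical phi' /\ forall e e', phi e = phi e' -> phi' e = phi' e'.
Proof.
move=> G_conn; have [r _ | G0] := pickP (fun _ : G => true).
  exact: spec_factor_rooted (G_conn r).
(* Without vertices there is no root to choose, and the zero coloring is vacuously canonical. *)
move=> _; exists 'rV_0, (fun=> 0); split=> //.
by exists (fun=> 0) => [u | e u]; have := G0 u.
Qed.

(** Choosing for each color of [psi] an edge that bears it, and taking the [phi]-color of that edge,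
    injects the colors of [psi] into those of [phi]. *)
Lemma leq_num_colors (G : sgraph) (C D : eqType) (phi : coloring G C)
    (psi : coloring G D) :
    (forall e e', phi e = phi e' -> psi e = psi e') ->
  (num_colors psi <= num_colors phi)%N.
Proof.
move=> phi_psi; pose h (d : D) := [pick e | psi e == d].
have hP e : exists2 e', h (psi e) = Some e' & psi e' = psi e.
  rewrite /h; case: pickP => [e' /eqP | /(_ e)]; first by exists e'.
  by rewrite eqxx.
rewrite /num_colors.
(* As [h] is partial, the two lists of colors are compared inside [option C]. *)
rewrite -(size_map (omap phi \o h)) -(size_map Some (undup (codom phi))).
apply: uniq_leq_size.
  rewrite map_inj_in_uniq ?undup_uniq // => d d'; rewrite !mem_undup.
  case/codomP=> e -> /codomP[e' ->] /=.
  have [e1 -> <-] := hP e; have [e2 -> <-] := hP e'.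
  by case=> /phi_psi.
move=> _ /mapP[d + ->]; rewrite mem_undup => /codomP[e ->] /=.
by have [e1 -> _] := hP e; apply: map_f; rewrite mem_undup codom_f.
Qed.

Theorem theorem1p5 (G : sgraph) (G_conn : connected G) :
  (forall (C : eqType) (phi : coloring G C), spec phi ->
     exists (V : lmodType 'F_2) (phi' : coloring G V),
       canonical phi' /\
       exists pi : used phi -> used phi',
         forall e : edge G, to_used phi' e = pi (to_used phi e)) /\
  spec_number G = canonical_number G.
Proof.
split=> [C phi phi_spec|].
  have [V [phi' [phi'_can phi_phi']]] := spec_factor G_conn phi_spec.
  exists V, phi'; split=> //.
  (* [iinv] picks an edge of color [c]; the choice is harmless because [phi'] is constant on each
     color class of [phi]. *)
  exists (fun c => to_used phi' (iinv (proj2_sig c))) => e.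
  apply: val_inj => /=; apply: phi_phi'.
  by rewrite f_iinv.
rewrite /spec_number /canonical_number.
case: ex_minnP => m /asboolP[C [phi [phi_spec <-]]] m_min.
case: ex_minnP => n /asboolP[V [psi [psi_can <-]]] n_min.
apply/eqP; rewrite eqn_leq; apply/andP; split.
  by apply: m_min; apply/asboolP; exists V, psi; split=> //; apply: canonical_spec.
(* Conversely, an optimal [phi] factors onto a canonical coloring, which uses no more colors. *)
have [W [phi' [phi'_can phi_phi']]] := spec_factor G_conn phi_spec.
apply: leq_trans (leq_num_colors phi_phi').
by apply: n_min; apply/asboolP; exists W, phi'.
Qed.
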